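(* Let $p\ge2$ be an integer, $\epsilon>0$, $M>0$, and $0<C\le M^{p-1}/p^p$. Let $f\colon\mathbb{R}^d\to\mathbb{R}$ be a continuously differentiable convex function with unique minimizer $x^*$, and let $h\colon\mathbb{R}^d\to\mathbb{R}$ be a distance-generating function that is $1$-uniformly convex of order $p$. Let $(x_k)_{k\ge0}$, $(y_k)_{k\ge0}$, $(z_k)_{k\ge0}$ be sequences in $\mathbb{R}^d$ with $z_0=x_0$ such that $$x_{k+1}=\frac{p}{k+p}\,z_k+\frac{k}{k+p}\,y_k\quad(k\ge0),\qquad z_k=\arg\min_{z\in\mathbb{R}^d}\Big\{Cp\,k^{(p-1)}\langle\nabla f(y_k),z\rangle+\frac1\epsilon D_h(z,z_{k-1})\Big\}\quad(k\ge1),$$ and such that for all $k\ge0$ $$\langle\nabla f(y_k),x_k-y_k\rangle\ge M\,\epsilon^{\frac1{p-1}}\,\|\nabla f(y_k)\|_*^{\frac p{p-1}}.$$ Then for all $k\ge1$ $$f(y_k)-f(x^* )\le\frac{D_h(x^*,x_0)}{C\,\epsilon\,k^{(p)}}=O\Big(\frac1{\epsilon k^p}\Big).$$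
   Context: $\|\cdot\|$ is the inner product norm $\|x\|=\langle x,x\rangle^{1/2}$ on $\mathbb{R}^d$ and $\|\cdot\|_*$ is its dual norm. A distance-generating function $h$ is convex and essentially smooth ($h$ is continuously differentiable and $\|\nabla h(x)\|_*\to\infty$ as $\|x\|\to\infty$). Its Bregman divergence is $D_h(y,x)=h(y)-h(x)-\langle\nabla h(x),y-x\rangle$. The function $h$ is $\sigma$-uniformly convex of order $p$ if $D_h(y,x)\ge\frac{\sigma}{p}\|y-x\|^p$ for all $x,y$. For integers $k\ge0$, $q\ge1$, $k^{(q)}=k(k+1)\cdots(k+q-1)$ denotes the rising factorial (so $k^{(p-1)}=k(k+1)\cdots(k+p-2)$). *)

(* Defs.v *)
From HB Require Import structures.
From mathcomp Require Import all_boot all_order all_algebra.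
From mathcomp Require Import all_classical all_reals all_analysis.
Set Implicit Arguments.
Unset Strict Implicit.
Unset Printing Implicit Defensive.
Import Order.TTheory GRing.Theory Num.Theory.
Import numFieldNormedType.Exports.
Local Open Scope classical_set_scope.
Local Open Scope ring_scope.

Section Euclidean.
Context {R : realType} {d : nat}.
Implicit Types (u v s x y : 'rV[R]_d) (h f : 'rV[R]_d -> R).

Definition inner u v : R := \sum_(i < d) u 0 i * v 0 i.

(* The library norm on 'rV[R]_d is the sup norm, which has the same topology
   (and the same differentiability) but is not the norm of an inner product. *)
Definition enorm x : R := Num.sqrt (inner x x).

Definition dual_norm s : R := sup [set inner s x | x in [set x | enorm x <= 1]].

Definition gradient f x : 'rV[R]_d := \row_(i < d) 'D_(delta_mx 0 i) f x.

Definition continuously_differentiable f : Prop :=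
  (forall x, differentiable f x) /\ continuous (gradient f).

Definition convex_on_space f : Prop :=
  convex_function (setT : set (convex_lmodType 'rV[R]_d)) f.

Definition essentially_smooth h : Prop :=
  continuously_differentiable h /\
  (forall A : R, exists B : R, forall x,
     B <= enorm x -> A <= dual_norm (gradient h x)).

Definition distance_generating h : Prop :=
  convex_on_space h /\ essentially_smooth h.

Definition bregman h y x : R := h y - h x - inner (gradient h x) (y - x).

Definition uniformly_convex (sigma : R) (p : nat) h : Prop :=
  forall x y, sigma / p%:R * enorm (y - x) ^+ p <= bregman h y x.

Definition argmin f : set 'rV[R]_d := [set x | forall y, f x <= f y].

End Euclidean.

Definition rising_factorial (k q : nat) : nat := (\prod_(i < q) (k + i))%N.

(* Lets [f =O_ (globally A) g] be written: it says |f| <= K |g| on all of A,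
   for some constant K. *)
Canonical globally_filter_on (T : Type) (A : set T) : filter_on T :=
  FilterType (globally A) (globally_filter A).

(* Main.v *)
(* With the weights A_k = C k^(p), whose increments are the step weights
   A_{k+1} - A_k = C p (k+1)^(p-1), the energy
     eps A_k (f(y_k) - f(x^* )) + D_h(x^*, z_k)
   is nonincreasing. Convexity of f at y_{k+1} and the optimality condition of
   the mirror step bound its increment by
     eps <g, A_{k+1} (y_{k+1} - x_{k+1}) + (A_{k+1} - A_k) (z_k - z_{k+1})>
       - D_h(z_{k+1}, z_k),   g = grad f(y_{k+1}),
   because A_{k+1} x_{k+1} = (A_{k+1} - A_k) z_k + A_k y_k. Young's inequality
   absorbs <g, z_k - z_{k+1}> into D_h(z_{k+1}, z_k), by uniform convexity of h,
   and into the assumed lower bound on <g, x_{k+1} - y_{k+1}>. Since A_0 = 0, the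
   initial energy is D_h(x^*, x_0). *)

Require Import Defs.
From HB Require Import structures.
From mathcomp Require Import all_boot all_order all_algebra.
From mathcomp Require Import all_classical all_reals all_analysis.
From mathcomp Require Import ring lra.
Import Order.TTheory GRing.Theory Num.Theory.
Import numFieldNormedType.Exports.
Local Open Scope classical_set_scope.
Local Open Scope ring_scope.

(** * Rising factorials *)

Lemma rising_factorialSr k n :
  rising_factorial k n.+1 = (rising_factorial k n * (k + n))%N.
Proof. by rewrite /rising_factorial big_ord_recr. Qed.

Lemma rising_factorialSl k n :
  rising_factorial k n.+1 = (k * rising_factorial k.+1 n)%N.
Proof.
rewrite /rising_factorial big_ord_recl addn0; congr (_ * _)%N.
by apply: eq_bigr => i _; rewrite addSnnS.
Qed.

Lemma rising_factorial0n n : rising_factorial 0 n.+1 = 0%N.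
Proof. by rewrite rising_factorialSl mul0n. Qed.

(** The discrete analogue of differentiating a power; it gives the increments of the weights
    [C k^(p)]. *)
Lemma rising_factorial_recl k n :
  rising_factorial k.+1 n.+1 =
  (rising_factorial k n.+1 + n.+1 * rising_factorial k.+1 n)%N.
Proof.
rewrite rising_factorialSr rising_factorialSl addSnnS mulnDr.
by rewrite !(mulnC _ (rising_factorial _ _)).
Qed.

Lemma leq_rising_factorial k n : (k ^ n <= rising_factorial k n)%N.
Proof.
elim: n => [|n IHn]; first by rewrite /rising_factorial big_ord0.
by rewrite rising_factorialSr expnSr leq_mul ?leq_addr.
Qed.

Lemma rising_factorial_gt0 k n : (0 < k)%N -> (0 < rising_factorial k n)%N.
Proof.
by move=> k0; rewrite (leq_trans _ (leq_rising_factorial k n)) ?expn_gt0 ?k0.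
Qed.

Lemma rising_factorial_leX k n : (rising_factorial k n <= (k + n) ^ n)%N.
Proof.
elim: n => [|n IHn]; first by rewrite /rising_factorial big_ord0.
rewrite rising_factorialSr expnSr leq_mul ?leq_add2l //.
by apply: leq_trans IHn _; case: n => // n; rewrite leq_exp2r // leq_add2l.
Qed.

(** Both sides share the factor [rising_factorial k n ^ n]; what remains is
    [rising_factorial k n <= (k + n) ^ n]. *)
Lemma rising_factorial_expn k n :
  (rising_factorial k n ^ n.+1 <= rising_factorial k n.+1 ^ n)%N.
Proof.
by rewrite rising_factorialSr expnMn expnSr leq_mul ?rising_factorial_leX.
Qed.

(** * Young's inequality *)

Lemma young_expr (R : realDomainType) (n : nat) (w t : R) : 0 <= w -> 0 <= t ->
  n.+1%:R * (w ^+ n * t) <= t ^+ n.+1 + n%:R * w ^+ n.+1.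
Proof.
move=> w0 t0; elim: n => [|n IHn]; first by rewrite !expr0 !mul0r !mul1r addr0.
have wn := exprn_ge0 n w0.
(* Adding [(n+1) w^n (t - w)^2 >= 0] to [t] times the induction hypothesis yields the next case. *)
have := mulr_ge0 (mulr_ge0 (ler0n R n.+1) wn) (sqr_ge0 (t - w)).
have := ler_wpM2r t0 IHn.
rewrite -!(@natr1 _ n.+1) -!(@natr1 _ n) !(exprS _ n.+1) !(exprS _ n).
move: (w ^+ n) (t ^+ n) (n%:R : R) => u v m.
by move=> H1 H2; lra.
Qed.

Section Roots.
Context {R : realType}.

Lemma powR_invn_expr (n : nat) (a : R) : 0 <= a -> (a `^ n.+1%:R^-1) ^+ n.+1 = a.
Proof.
move=> a0.
by rewrite -powR_mulrn ?powR_ge0 // -powRrM mulVf ?powRr1 ?pnatr_eq0.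
Qed.

(** Passing to (n+1)-th roots of [eps], [G] and [a] leaves only integer powers. Young's inequality
    then applies to [w = e b s] and [t = r], and [b^(n+2) <= N] bounds the remainder. *)
Lemma young_step (n : nat) (eps a N G r : R) :
  0 < eps -> 0 <= a -> 0 <= N -> 0 <= G -> 0 <= r -> a ^+ n.+2 <= N ^+ n.+1 ->
  eps * a * (G * r) <= r ^+ n.+2 / n.+2%:R
    + eps * (N * eps `^ n.+1%:R^-1 * G `^ (n.+2%:R / n.+1%:R)).
Proof.
move=> eps0 a0 N0 G0 r0 aN.
set e := eps `^ _; set s := G `^ n.+1%:R^-1; set b := a `^ n.+1%:R^-1.
have e0 : 0 <= e by exact: powR_ge0.
have s0 : 0 <= s by exact: powR_ge0.
have b0 : 0 <= b by exact: powR_ge0.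
have -> : G `^ (n.+2%:R / n.+1%:R) = s ^+ n.+2.
  by rewrite mulrC powRrM powR_mulrn.
have epsE : eps = e ^+ n.+1 by rewrite powR_invn_expr // ltW.
have GE : G = s ^+ n.+1 by rewrite powR_invn_expr.
have aE : a = b ^+ n.+1 by rewrite powR_invn_expr.
have bN : b ^+ n.+2 <= N.
  by rewrite -(@ler_pXn2r _ n.+1) ?nnegrE ?exprn_ge0 // -exprM mulnC exprM -aE.
have w0 : 0 <= e * b * s by rewrite !mulr_ge0.
have p0 : 0 < (n.+2%:R : R) by rewrite ltr0n.
have Y : (e * b * s) ^+ n.+1 * r <=
    r ^+ n.+2 / n.+2%:R + (e * b * s) ^+ n.+2.
  rewrite -(ler_pM2l p0) mulrDr [_ * (_ / _)]mulrC divfK ?gt_eqF //.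
  apply: le_trans (young_expr _ n.+1 _ _ w0 r0) _.
  (* The coefficient [n+1] from Young's inequality is weakened to [n+2], so that no fraction
     [(p-1)/p] survives. *)
  by rewrite lerD2l ler_wpM2r ?exprn_ge0 // ler_nat.
rewrite {1}epsE GE aE mulrA -!exprMn; apply: le_trans Y _.
rewrite lerD2l epsE.
rewrite (_ : _ * (_ * _ * _) = e ^+ n.+2 * N * s ^+ n.+2); last first.
  by rewrite (exprS e n.+1); ring.
by rewrite !exprMn ler_wpM2r ?exprn_ge0 // ler_wpM2l ?exprn_ge0.
Qed.

End Roots.

(** * Dual norm, gradients and mirror steps *)

Section Inner.
Context {R : realType} {d : nat}.
Implicit Types (u v s w x : 'rV[R]_d) (f : 'rV[R]_d -> R).

Lemma innerDr s u v : inner s (u + v) = inner s u + inner s v.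
Proof. by rewrite /inner -big_split; apply: eq_bigr => i _; rewrite mxE mulrDr. Qed.

Lemma innerZr s (a : R) u : inner s (a *: u) = a * inner s u.
Proof. by rewrite /inner mulr_sumr; apply: eq_bigr => i _; rewrite mxE mulrCA. Qed.

Lemma innerBr s u v : inner s (u - v) = inner s u - inner s v.
Proof. by rewrite innerDr -scaleN1r innerZr mulN1r. Qed.

Lemma coord_le_enorm u (i : 'I_d) : `|u 0 i| <= enorm u.
Proof.
rewrite -sqrtr_sqr ler_wsqrtr // /inner (bigD1 i) //= -expr2 lerDl.
by apply: sumr_ge0 => j _; rewrite -expr2 sqr_ge0.
Qed.

Lemma enormZ (a : R) u : 0 <= a -> enorm (a *: u) = a * enorm u.
Proof.
move=> a0; rewrite /enorm innerZr.
rewrite (_ : inner (a *: u) u = a * inner u u).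
  by rewrite mulrA -expr2 sqrtrM ?sqr_ge0 // sqrtr_sqr ger0_norm.
by rewrite /inner mulr_sumr; apply: eq_bigr => i _; rewrite mxE mulrA.
Qed.

(** [sup] defaults to 0 on sets without a supremum, so existence comes before any use of [dual_norm]
    as a bound. Coordinates in the unit ball are at most 1 in absolute value, hence the l1 norm of
    [s] is an upper bound. *)
Lemma dual_norm_has_sup s : has_sup [set inner s x | x in [set x | enorm x <= 1]].
Proof.
split.
  exists (inner s 0), 0 => //=; rewrite -(scale0r (0 : 'rV[R]_d)) enormZ //.
  by rewrite mul0r ler01.
exists (\sum_i `|s 0 i|) => _ [u u1 <-]; apply: ler_sum => i _.
rewrite (le_trans (ler_norm _)) // normrM ler_piMr //.
exact: le_trans (coord_le_enorm u i) u1.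
Qed.

Lemma dual_norm_ge0 s : 0 <= dual_norm s.
Proof.
apply: sup_upper_bound; first exact: dual_norm_has_sup.
exists 0; last by rewrite -(scale0r (0 : 'rV[R]_d)) innerZr mul0r.
by rewrite /= -(scale0r (0 : 'rV[R]_d)) enormZ // mul0r ler01.
Qed.

Lemma inner_le_dual_norm s u : inner s u <= dual_norm s * enorm u.
Proof.
have [u0|u0] := eqVneq (enorm u) 0.
  suff -> : inner s u = 0 by rewrite u0 mulr0.
  rewrite /inner big1 // => i _; have := coord_le_enorm u i.
  by rewrite u0 normr_le0 => /eqP ->; rewrite mulr0.
have {}u0 : 0 < enorm u by rewrite lt_def u0 sqrtr_ge0.
rewrite -ler_pdivrMr // mulrC -innerZr.
apply: sup_upper_bound; first exact: dual_norm_has_sup.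
by exists ((enorm u)^-1 *: u) => //=; rewrite enormZ ?mulVf ?gt_eqF // invr_ge0 ltW.
Qed.

Lemma derive_gradient f x v : differentiable f x -> 'D_v f x = inner (gradient f x) v.
Proof.
move=> df; rewrite deriveE // {1}[v]row_sum_delta linear_sum.
by apply: eq_bigr => i _; rewrite linearZ /= mxE deriveE // mulrC.
Qed.

(** The derivative along [v] is also the limit of the difference quotients over [t > 0] alone, and
    those with [t <= 1] are at least [c]. Serves both the tangent inequality and the optimality of
    mirror steps. *)
Lemma ge_slope_gradient f x v (c : R) : differentiable f x ->
  (forall t, 0 < t -> t <= 1 -> t * c <= f (x + t *: v) - f x) ->
  c <= inner (gradient f x) v.
Proof.
move=> df fc; rewrite -derive_gradient //.
have dfv : derivable f x v by exact: diff_derivable.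
have qv : (fun t => t^-1 *: ((f \o shift x) (t *: v) - f x)) @ 0^'+ --> ('D_v f x : R).
  apply: cvg_trans dfv; apply: cvg_app.
  by apply: within_subset => t /=; exact: lt0r_neq0.
apply: (cvgr_to_ge qv).
near=> t.
have t0 : 0 < t by [].
rewrite -(ler_pM2l t0) -[_ *: _]/(_ * _) mulVKf ?gt_eqF //= [t *: v + x]addrC.
by apply: fc => //; near: t; exact: nbhs_right_le.
Unshelve. all: by end_near.
Qed.

Lemma convex_gradient f x w : convex_on_space f -> differentiable f x ->
  inner (gradient f x) (w - x) <= f w - f x.
Proof.
(* Negation turns the upper bound on slopes given by convexity into the lower bound that
   [ge_slope_gradient] asks for. *)
move=> cf df; rewrite -lerN2 -derive_gradient // -deriveN; last exact: diff_derivable.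
have dNf : differentiable (- f) x by exact: differentiableN.
rewrite derive_gradient //; apply: ge_slope_gradient => // t t0 t1.
have := cf (Itv01 (ltW t0) t1) w x (mem_set I) (mem_set I).
rewrite convRE /conv /= /unstable.onem.
have -> : t *: w + (1 - t) *: x = x + t *: (w - x).
  by rewrite scalerBl scale1r scalerBr addrCA.
by rewrite !opprfctE => fle; lra.
Qed.

Lemma bregman_ge0 (p : nat) f u x : uniformly_convex 1 p f -> 0 <= bregman f u x.
Proof.
move=> fuc; apply: le_trans (fuc x u).
by rewrite mulr_ge0 ?divr_ge0 // exprn_ge0 // sqrtr_ge0.
Qed.

(* The optimality condition of a mirror descent step, contracted with [w - v]
   and rewritten by the three-point identity of the Bregman divergence. *)
Lemma bregman_prox (eps c : R) f s u v w : 0 < eps -> differentiable f v ->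
  argmin (fun x => c * inner s x + eps^-1 * bregman f x u) v ->
  eps * c * (inner s v - inner s w) <=
    bregman f w u - bregman f w v - bregman f v u.
Proof.
move=> eps0 df vmin.
suff : inner (gradient f u) (w - v) - eps * c * inner s (w - v) <=
    inner (gradient f v) (w - v) by rewrite /bregman !innerBr; lra.
(* Apart from [f], the objective scaled by [eps] is affine, so minimality along the segment from [v]
   to [w] bounds the increments of [f] below linearly. *)
apply: ge_slope_gradient => // t t0 t1.
have := ler_wpM2l (ltW eps0) (vmin (v + t *: (w - v))).
rewrite /= !mulrDr !mulVKf ?gt_eqF //.
by rewrite /bregman !(innerBr, innerDr, innerZr); lra.
Qed.

End Inner.

(** * One step of the energy argument *)

Lemma energy_decrease {R : realType} {d : nat} (n : nat) (eps N A a : R)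
    (f h : 'rV[R]_d -> R) (xstar x' y y' z z' : 'rV[R]_d) :
  0 < eps -> 0 <= N -> 0 <= A -> 0 <= a -> a ^+ n.+2 <= N ^+ n.+1 ->
  (forall u, differentiable f u) -> convex_on_space f ->
  (forall u, differentiable h u) -> uniformly_convex 1 n.+2 h ->
  (A + a) *: x' = a *: z + A *: y ->
  argmin (fun w => a * inner (gradient f y') w + eps^-1 * bregman h w z) z' ->
  N * eps `^ n.+1%:R^-1 * dual_norm (gradient f y') `^ (n.+2%:R / n.+1%:R)
    <= (A + a) * inner (gradient f y') (x' - y') ->
  eps * (A + a) * (f y' - f xstar) + bregman h xstar z' <=
  eps * A * (f y - f xstar) + bregman h xstar z.
Proof.
move=> eps_gt0 N_ge0 A_ge0 a_ge0 aN f_diff f_convex h_diff h_uc x'E z'min y'cond.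
have prox := bregman_prox _ _ _ _ _ _ xstar eps_gt0 (h_diff _) z'min.
have xyz : (A + a) * inner (gradient f y') x' =
    a * inner (gradient f y') z + A * inner (gradient f y') y.
  by rewrite -innerZr x'E innerDr !innerZr.
have cvx w := convex_gradient _ _ w f_convex (f_diff y').
have descent := ler_wpM2l (mulr_ge0 (ltW eps_gt0) A_ge0) (cvx y).
have optim := ler_wpM2l (mulr_ge0 (ltW eps_gt0) a_ge0) (cvx xstar).
have uc := h_uc z z'.
have dist : enorm (z - z') = enorm (z' - z).
  congr Num.sqrt; apply: eq_bigr => i _; rewrite !mxE; ring.
have step := young_step n _ _ _ _ _ eps_gt0 a_ge0 N_ge0
  (dual_norm_ge0 (gradient f y')) (sqrtr_ge0 _ : 0 <= enorm (z' - z)) aN.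
have cs := ler_wpM2l (mulr_ge0 (ltW eps_gt0) a_ge0)
  (inner_le_dual_norm (gradient f y') (z - z')).
have ycond := ler_wpM2l (ltW eps_gt0) y'cond.
move: prox descent optim uc step cs ycond xyz; rewrite dist !innerBr mul1r.
rewrite [n.+2%:R^-1 * _]mulrC.
(* With these nonlinear terms as atoms, and [xyz] multiplied by [eps], the claim is a linear
   combination of the facts above. *)
set Y := (_ * _ `^ (_ / _)); set P := _ ^+ _ / _; set Q := dual_norm _ * _.
move: (inner (gradient f y')) => g.
move=> prox descent optim uc step cs ycond xyz.
have {}xyz : eps * (a * g z + A * g y) = eps * ((A + a) * g x') by rewrite xyz.
lra.
Qed.

(* The condition on [C] gives [a ^ p <= N ^ (p - 1)] for the increment [a] of
   the weight at step [k] and [N = M C k^(p)], with [p = n + 2]. *)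
Lemma weight_increment_le (R : realType) (n k : nat) (C M : R) :
  0 < C -> 0 < M -> C <= M ^+ n.+1 / n.+2%:R ^+ n.+2 ->
  (C * n.+2%:R * (rising_factorial k n.+1)%:R) ^+ n.+2 <=
  (C * (rising_factorial k n.+2)%:R * M) ^+ n.+1.
Proof.
move=> C0 M0; rewrite ler_pdivlMr ?exprn_gt0 ?ltr0n // => CM.
(* Cancelling [C^(n+1)] splits the claim into two factors: the hypothesis on [C], and the comparison
   of rising factorials. *)
rewrite !exprMn (exprS C n.+1) -!natrX -!mulrA mulrCA ler_pM2l ?exprn_gt0 //.
rewrite mulrA [leRHS]mulrC ler_pM ?mulr_ge0 ?ler0n ?(ltW C0) //.
  by rewrite natrX.
by rewrite ler_nat rising_factorial_expn.
Qed.

Section Weights.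
Context {R : realFieldType}.
Implicit Types C : R.

Lemma weightS (n k : nat) C :
  C * (rising_factorial k n.+1)%:R + C * n.+1%:R * (rising_factorial k.+1 n)%:R
  = C * (rising_factorial k.+1 n.+1)%:R.
Proof. by rewrite rising_factorial_recl natrD natrM mulrDr mulrA. Qed.

(** The coefficients agree because, as rising factorials, [(k+1)^(n+1) = (k+1)^(n) (k+n+1)] and
    [k^(n+1) = k (k+1)^(n)]. *)
Lemma weight_average {d : nat} (n k : nat) C (y z : 'rV[R]_d) :
  (C * (rising_factorial k.+1 n.+1)%:R) *:
    ((n.+1%:R / (k + n.+1)%:R) *: z + (k%:R / (k + n.+1)%:R) *: y) =
  (C * n.+1%:R * (rising_factorial k.+1 n)%:R) *: z +
  (C * (rising_factorial k n.+1)%:R) *: y.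
Proof.
have kn0 : (k + n.+1)%:R != 0 :> R by rewrite pnatr_eq0 addnS.
rewrite scalerDr !scalerA rising_factorialSr rising_factorialSl !natrM addSnnS.
by congr (_ *: _ + _ *: _); move: (k + n.+1)%:R kn0 => m m0; field.
Qed.

End Weights.

(** * Convergence rate *)

Theorem theorem3p1 (R : realType) (d p : nat) (eps M C : R)
    (f h : 'rV[R]_d -> R) (xstar : 'rV[R]_d) (x y z : nat -> 'rV[R]_d)
    (p_ge2 : (2 <= p)%N)
    (eps_gt0 : 0 < eps)
    (M_gt0 : 0 < M)
    (C_gt0 : 0 < C)
    (C_le : C <= M ^+ p.-1 / p%:R ^+ p)
    (f_C1 : continuously_differentiable f)
    (f_convex : convex_on_space f)
    (f_min : argmin f = [set xstar])
    (h_dgf : distance_generating h)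
    (h_uc : uniformly_convex 1 p h)
    (zx0 : z 0%N = x 0%N)
    (x_rec : forall k : nat,
       x k.+1 = (p%:R / (k + p)%:R) *: z k + (k%:R / (k + p)%:R) *: y k)
    (z_argmin : forall k : nat, (1 <= k)%N ->
       z k \in argmin (fun w =>
         C * p%:R * (rising_factorial k p.-1)%:R * inner (gradient f (y k)) w
         + eps^-1 * bregman h w (z k.-1)))
    (y_cond : forall k : nat,
       M * eps `^ (p.-1%:R)^-1
         * dual_norm (gradient f (y k)) `^ (p%:R / p.-1%:R)
       <= inner (gradient f (y k)) (x k - y k)) :
  (forall k : nat, (1 <= k)%N ->
     f (y k) - f xstar
     <= bregman h xstar (x 0%N) / (C * eps * (rising_factorial k p)%:R))
  /\
  (* the big-O, uniform in the step size e > 0 and in k >= 1 *)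
  (fun q : R * nat =>
     bregman h xstar (x 0%N) / (C * q.1 * (rising_factorial q.2 p)%:R) : R^o)
  =O_ (globally [set q : R * nat | 0 < q.1 /\ (1 <= q.2)%N])
  (fun q : R * nat => (q.1 * q.2%:R ^+ p)^-1 : R^o).
Proof.
have [f_diff _] := f_C1; have [_ [[h_diff _] _]] := h_dgf.
case: p p_ge2 C_le h_uc x_rec z_argmin y_cond => [|[|n]] // _ {}C_le {}h_uc.
move=> {}x_rec {}z_argmin {}y_cond.
have D_ge0 u v : 0 <= bregman h u v by exact: bregman_ge0 h_uc.
have energy k : eps * (C * (rising_factorial k n.+2)%:R) * (f (y k) - f xstar)
    + bregman h xstar (z k) <= bregman h xstar (x 0%N).
  elim: k => [|k]; first by rewrite rising_factorial0n !(mulr0, mul0r) add0r zx0.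
  apply: le_trans; rewrite -(weightS n.+1 k).
  (* Here [N = A_{k+1} M], since the assumed lower bound at [y k.+1] is used with the factor
     [A_{k+1}]. *)
  apply: (energy_decrease _ _ (C * (rising_factorial k.+1 n.+2)%:R * M)
    _ _ _ _ _ (x k.+1)) => //.
  - by rewrite !mulr_ge0 ?ler0n // ltW.
  - by rewrite mulr_ge0 ?ler0n // ltW.
  - by rewrite !mulr_ge0 ?ler0n // ltW.
  - exact: weight_increment_le.
  - by rewrite weightS x_rec weight_average.
  - by have /set_mem := z_argmin k.+1 isT.
  - rewrite weightS -[leLHS]mulrA -[_ * M * _]mulrA.
    apply: ler_wpM2l; first by rewrite mulr_ge0 ?ler0n // ltW.
    by rewrite mulrA.
split.
  move=> k k1; have rf0 : 0 < (rising_factorial k n.+2)%:R :> R.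
    by rewrite ltr0n rising_factorial_gt0.
  rewrite ler_pdivlMr ?mulr_gt0 // mulrC (mulrC C) -(mulrA eps).
  (* The nonnegative term [bregman h xstar (z k)] of the energy is dropped. *)
  by apply: le_trans (energy k); rewrite lerDl.
(* The added 1 keeps the constant strictly positive even if the initial divergence vanishes. *)
apply/eqO_exP; exists (bregman h xstar (x 0%N) / C + 1).
  by rewrite ltr_wpDl // divr_ge0 // ltW.
move=> [e k] [/= e0 k1].
have k0 : 0 < k%:R :> R by rewrite ltr0n.
have rf0 : 0 < (rising_factorial k n.+2)%:R :> R.
  by rewrite ltr0n rising_factorial_gt0.
rewrite !ger0_norm; first last.
- by rewrite divr_ge0 // !mulr_ge0 // ltW.
- by rewrite invr_ge0 mulr_ge0 ?exprn_ge0 // ltW.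
rewrite -[C * e * _]mulrA invfM mulrA ler_pM ?lerDl //.
- by rewrite divr_ge0 // ltW.
- by rewrite invr_ge0 mulr_ge0 // ltW.
have kn0 : 0 < k%:R ^+ n.+2 :> R by exact: exprn_gt0.
rewrite lef_pV2 ?posrE; [|exact: mulr_gt0..].
rewrite ler_pM2l //.
by rewrite -natrX ler_nat leq_rising_factorial.
Qed.
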